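(* Let $1\le P\le N$ and $1\le Q\le M$ be integers. Let $UC$ be the set of unique combinations, and for each $(\Delta r,\Delta c)\in UC$ let $W(\Delta r,\Delta c)$ be its set of target indices in the $PQ\times PQ$ output matrix. Then the sets $W(\Delta r,\Delta c)$, $(\Delta r,\Delta c)\in UC$, jointly cover the entire upper triangle: every index $(a,b)$ with $1\le a\le b\le PQ$ belongs to $W(\Delta r,\Delta c)$ for some $(\Delta r,\Delta c)\in UC$. Moreover, any given index of the output matrix is written to by a single combination: no index belongs to $W(\Delta r,\Delta c)$ for two different elements $(\Delta r,\Delta c)\in UC$.
   Context: All indices start at 1. The input matrix $A$ has size $N\times M$. For $1\le p\le N-P+1$, $1\le q\le M-Q+1$, the window $S^{p,q}$ is the $P\times Q$ block of $A$ with upper left corner at position $(p,q)$, so $S^{p,q}(i,j)=A_{p+i-1,\,q+j-1}$ for $1\le i\le P$, $1\le j\le Q$. Its column stack is the vector $\vec V^{p,q}$ of length $PQ$ with $\vec V^{p,q}(P(j-1)+i)=S^{p,q}(i,j)$. The output matrix $C$ (size $PQ\times PQ$) is the sum over the window positions of $\vec V^{p,q}(\vec V^{p,q})^H$. The inter-element distance of an ordered pair of positions $((r_1,c_1),(r_2,c_2))$ of $A$ is $(r_2-r_1,\,c_2-c_1)$. A combination is the set of all products $A_{r_1,c_1}\overline{A_{r_2,c_2}}$ over ordered pairs of positions with a given inter-element distance $(\Delta r,\Delta c)$, where $-(P-1)\le\Delta r\le P-1$ and $-(Q-1)\le\Delta c\le Q-1$; products are treated formally, i.e. identified by the pair of positions,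 and the combination is denoted by $(\Delta r,\Delta c)$. The set of unique combinations is $$UC=\{(\Delta r,\Delta c): 0\le\Delta r\le P-1,\ 0\le\Delta c\le Q-1\}\cup\{(\Delta r,\Delta c): -(P-1)\le\Delta r\le -1,\ 1\le\Delta c\le Q-1\}.$$ Target (write) indices: if a window $S^{p,q}$ contains both positions $(r_1,c_1)$ and $(r_2,c_2)$, with coordinates $(i_1,j_1)=(r_1-p+1,\,c_1-q+1)$ and $(i_2,j_2)=(r_2-p+1,\,c_2-q+1)$ within the window, then the product $A_{r_1,c_1}\overline{A_{r_2,c_2}}$ is written, in the context of that window, to the output index $(P(j_1-1)+i_1,\ P(j_2-1)+i_2)$. The set $W(\Delta r,\Delta c)$ of target indices of a combination is the set of all output indices to which some product in the combination is written in the context of some window containing its two positions. The upper triangle of the output matrix is the set of indices $(a,b)$ with $1\le a\le b\le PQ$ (main diagonal included). *)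

(* Defs.v *)
From mathcomp Require Import all_boot all_order all_algebra.
From mathcomp Require Import all_classical.

Set Implicit Arguments.
Unset Strict Implicit.
Unset Printing Implicit Defensive.

Import Order.TTheory GRing.Theory Num.Theory.
Local Open Scope ring_scope.
Local Open Scope classical_set_scope.

(* All indices are integers starting at 1.  Working in [int] rather than [nat]
   makes every subtraction below an honest one.  A pair is (row, column). *)

(* A formal product A_x * conj(A_y) is identified with the ordered pair of
   positions (x, y); the entries of A play no role. *)
Definition position := (int * int)%type.
Definition product := (position * position)%type.

Definition positions (N M : nat) : set position :=
  [set x | 1 <= x.1 <= N%:Z /\ 1 <= x.2 <= M%:Z].

Definition distance (x y : position) : int * int := (y.1 - x.1, y.2 - x.2).

Definition combination (N M : nat) (d : int * int) : set product :=
  [set z | [/\ positions N M z.1, positions N M z.2 & distance z.1 z.2 = d]].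

(* w = (p, q) is the position in A of the upper left corner of S^{p,q}. *)
Definition windows (N M P Q : nat) : set position :=
  [set w | 1 <= w.1 <= N%:Z - P%:Z + 1 /\ 1 <= w.2 <= M%:Z - Q%:Z + 1].

Definition window_coord (w x : position) : int * int :=
  (x.1 - w.1 + 1, x.2 - w.2 + 1).

Definition in_window (P Q : nat) (w x : position) : Prop :=
  1 <= (window_coord w x).1 <= P%:Z /\ 1 <= (window_coord w x).2 <= Q%:Z.

(* Index of the window entry (i, j) in the column stack of a P-row window. *)
Definition stack_index (P : nat) (ij : int * int) : int :=
  P%:Z * (ij.2 - 1) + ij.1.

Definition target_index (P : nat) (w : position) (z : product) : int * int :=
  (stack_index P (window_coord w z.1), stack_index P (window_coord w z.2)).

Definition target_indices (N M P Q : nat) (d : int * int) : set (int * int) :=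
  [set ab | exists z w,
     [/\ combination N M d z, windows N M P Q w,
         in_window P Q w z.1, in_window P Q w z.2 &
         target_index P w z = ab]].

Definition unique_combinations (P Q : nat) : set (int * int) :=
  [set d | 0 <= d.1 <= P%:Z - 1 /\ 0 <= d.2 <= Q%:Z - 1] `|`
  [set d | - (P%:Z - 1) <= d.1 <= - 1 /\ 1 <= d.2 <= Q%:Z - 1].

(* Main.v *)
Require Import Defs.
From mathcomp Require Import all_boot all_order all_algebra.
From mathcomp Require Import all_classical.
From mathcomp Require Import zify.

Set Implicit Arguments.
Unset Strict Implicit.
Unset Printing Implicit Defensive.

Import Order.TTheory GRing.Theory Num.Theory.
Local Open Scope ring_scope.
Local Open Scope classical_set_scope.

(** An index of the column stack determines the in-window coordinates, so the inter-element
    distance is a function of the output index alone.  Conversely the column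
    stack orders coordinates lexicographically by (column, row), which is why
    the distances of upper-triangle indices are exactly those in UC; the single
    window (1, 1) already realizes all of them. *)

(** A column step shifts the index by [P], while rows in [1..P] differ by at most [P - 1] and cannot
    compensate for it. *)
Lemma stack_index_le_lex (P : nat) (u v : int * int) :
  1 <= u.1 <= P%:Z -> 1 <= v.1 <= P%:Z ->
  stack_index P u <= stack_index P v -> u.2 < v.2 \/ u.2 = v.2 /\ u.1 <= v.1.
Proof.
rewrite /stack_index => hu hv huv.
have [lt_uv|lt_vu|eq_uv] := ltgtP u.2 v.2; [by left | | right].
  have : P%:Z * 1 <= P%:Z * (u.2 - v.2) by apply: ler_wpM2l; lia.
  by lia.
by split=> //; rewrite eq_uv in huv; lia.
Qed.

Lemma stack_index_inj (P : nat) (u v : int * int) :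
  1 <= u.1 <= P%:Z -> 1 <= v.1 <= P%:Z ->
  stack_index P u = stack_index P v -> u = v.
Proof.
case: u v => [i j] [i' j'] hu hv euv.
have := stack_index_le_lex hu hv; have := stack_index_le_lex hv hu.
rewrite euv lexx => /(_ isT) /= h1 /(_ isT) /= h2.
by congr pair; lia.
Qed.

(** Euclidean division of [a - 1] by [P]: the remainder gives the row and the quotient the column,
    both shifted back to start at 1. *)
Lemma stack_index_surj (P Q : nat) (a : int) : 1 <= a <= P%:Z * Q%:Z ->
  exists u : int * int, [/\ 1 <= u.1 <= P%:Z, 1 <= u.2 <= Q%:Z & stack_index P u = a].
Proof.
case: P => [|p]; first lia.
move=> ha.
have P0 : p.+1%:Z != 0 by [].
have eq_a := divz_eq (a - 1) p.+1%:Z.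
have r_ge0 := modz_ge0 (a - 1) P0.
have r_lt : ((a - 1) %% p.+1%:Z)%Z < p.+1%:Z by apply: ltz_pmod.
have q_ge0 : 0 <= ((a - 1) %/ p.+1%:Z)%Z by rewrite divz_ge0 //; lia.
have q_lt : ((a - 1) %/ p.+1%:Z)%Z < Q%:Z by rewrite ltz_divLR //; lia.
exists (((a - 1) %% p.+1%:Z)%Z + 1, ((a - 1) %/ p.+1%:Z)%Z + 1).
by rewrite /stack_index /=; split; lia.
Qed.

Lemma distance_window_coord (w x y : position) :
  distance (window_coord w x) (window_coord w y) = distance x y.
Proof. by rewrite /distance /=; congr pair; lia. Qed.

Theorem mainTheorem1 (N M P Q : nat)
    (hP : (1 <= P <= N)%N) (hQ : (1 <= Q <= M)%N) :
  (forall a b : int, 1 <= a -> a <= b -> b <= P%:Z * Q%:Z ->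
     exists2 d, unique_combinations P Q d & target_indices N M P Q d (a, b)) /\
  (forall (a b : int) (d d' : int * int),
     unique_combinations P Q d -> unique_combinations P Q d' ->
     target_indices N M P Q d (a, b) -> target_indices N M P Q d' (a, b) ->
     d = d').
Proof.
split=> [a b a_ge1 le_ab b_le | a b d d' _ _].
  have [|u [u1 u2 eq_a]] := @stack_index_surj P Q a; first by lia.
  have [|v [v1 v2 eq_b]] := @stack_index_surj P Q b; first by lia.
  have lex_uv : u.2 < v.2 \/ u.2 = v.2 /\ u.1 <= v.1.
    by apply: (@stack_index_le_lex P); rewrite ?eq_a ?eq_b.
  exists (distance u v).
    rewrite /unique_combinations /distance /=.
    (* If the row difference is negative, [lex_uv] forces a strict column increase, as the second
       part of UC demands. *)
    have [le_uv | lt_vu] := lerP u.1 v.1; [left | right]; rewrite /=.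
      by lia.
    by lia.
  (* In window [(1, 1)] coordinates are positions, so [u] and [v] themselves form the product;
     [P <= N] and [Q <= M] keep them inside the matrix. *)
  have coord1 x : window_coord (1, 1) x = x.
    by case: x => i j; rewrite /window_coord /= !subrK.
  exists (u, v), (1, 1); split; rewrite /in_window /target_index ?coord1 //=.
  - by split=> //; rewrite /positions /=; lia.
  - by rewrite /windows /=; lia.
  - by rewrite eq_a eq_b.
move=> [z [w [[_ _ <-] _ [z1 _] [z2 _] [eq_a eq_b]]]].
move=> [z' [w' [[_ _ <-] _ [z1' _] [z2' _] [eq_a' eq_b']]]].
(* The windows [w] and [w'] may differ, but the coordinates in each are recovered from the same [a]
   and [b]. *)
rewrite -(distance_window_coord w z.1) -(distance_window_coord w' z'.1).
by congr distance; apply: (@stack_index_inj P); rewrite // ?eq_a ?eq_b.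
Qed.
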